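(* Let $L$ be a bounded lattice, $\Lambda$ a meet-dense set of elements of $L$, and $\neg$ an antitone unary operation on $L$. Let $P=\{(a,\neg a)\mid a\in L\}\cup\{(1,b)\mid b\in\Lambda\}$, define $\vartriangleleft$ on $P$ by $(a,b)\vartriangleleft(c,d)$ iff $c\not\le b$, and let $F=c_\vartriangleleft(\{(\neg1,\neg\neg1)\})$. Then there is a complete embedding of $(L,\neg)$ into $(\mathfrak{L}(P,\vartriangleleft),\neg_{\vartriangleleft,F})$, which is an isomorphism if $L$ is complete.
   Context: A set is meet-dense in $L$ if every element of $L$ is the meet of some subset of it. Antitone: $a\le b$ implies $\neg b\le\neg a$. For a nonempty set $X$ with binary relation $\vartriangleleft$ (write $y\vartriangleright x$ for $x\vartriangleleft y$): $c_\vartriangleleft(A)=\{x\mid\forall x'\vartriangleleft x\ \exists x''\vartriangleright x':x''\in A\}$; $\mathfrak{L}(X,\vartriangleleft)$ is the complete lattice of sets $A$ with $c_\vartriangleleft(A)=A$, ordered by inclusion (meets are intersections, joins are $c_\vartriangleleft$ of unions). For a $c_\vartriangleleft$-fixpoint $F$, $\neg_{\vartriangleleft,F}A=\{x\in X\mid\forall x'\vartriangleleft x\,(x'\in A\Rightarrow\exists x''\vartriangleright x':x''\in F)\}$. A complete embedding of $(L,\neg)$ into $(L',\neg')$ is an injective map preserving all existing meets and joins and commuting with negation. *)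

(* Defs.v *)
From HB Require Import structures.
From mathcomp Require Import all_boot all_order.
From mathcomp Require Import boolp classical_sets.

Set Implicit Arguments.
Unset Strict Implicit.
Unset Printing Implicit Defensive.

Import Order.TTheory.
Local Open Scope classical_set_scope.
Local Open Scope order_scope.

(** [r x y] reads "x ◁ y". *)

Section Closure.
Context {X : Type} (r : X -> X -> Prop).
Implicit Types A B F : set X.

Definition cl A : set X :=
  [set x | forall x', r x' x -> exists2 x'', r x' x'' & A x''].

Definition neg_set F A : set X :=
  [set x | forall x', r x' x -> A x' -> exists2 x'', r x' x'' & F x''].

Lemma cl_sub A : A `<=` cl A.
Proof. by move=> x Ax x' rx; exists x. Qed.

Lemma clS A B : A `<=` B -> cl A `<=` cl B.
Proof. by move=> AB x clx x' /clx[x'' ? /AB]; exists x''. Qed.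

Lemma cl_idem A : cl (cl A) = cl A.
Proof.
apply/seteqP; split; last exact: cl_sub.
by move=> x clx x' /clx[x'' rx'' clx'']; exact: clx''.
Qed.

Lemma cl_neg_set F A : cl (neg_set F A) = neg_set F A.
Proof.
apply/seteqP; split; last exact: cl_sub.
by move=> x clx x' /clx[x'' rx'' nx''] Ax'; exact: nx''.
Qed.

Record cl_fixset := ClFixset { cl_fixset_val :> set X; _ : cl cl_fixset_val == cl_fixset_val }.

HB.instance Definition _ := [isSub for cl_fixset_val].
HB.instance Definition _ := [Choice of cl_fixset by <:].
HB.instance Definition _ := [SubChoice_isSubPOrder of cl_fixset by <: with
  Order.Disp tt tt].

Lemma cl_fixsetE (A : cl_fixset) : cl A = A.
Proof. by case: A => A /= /eqP. Qed.

Lemma cl_fixset_le (A B : cl_fixset) : (A <= B) = `[< (A : set X) `<=` B >].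
Proof. by []. Qed.

Definition cl_fix A : cl_fixset := ClFixset (introT eqP (cl_idem A)).

Definition neg_fix (F A : cl_fixset) : cl_fixset :=
  ClFixset (introT eqP (cl_neg_set F A)).

Lemma cl_bigcap (S : set cl_fixset) :
  cl (\bigcap_(A in S) (A : set X)) == \bigcap_(A in S) (A : set X).
Proof.
apply/eqP/seteqP; split; last exact: cl_sub.
by move=> x clx A SA; rewrite -cl_fixsetE; apply: clS clx => y; apply.
Qed.

Definition cl_fixset_inf (S : set cl_fixset) : cl_fixset := ClFixset (cl_bigcap S).

Definition cl_fixset_sup (S : set cl_fixset) : cl_fixset :=
  cl_fix (\bigcup_(A in S) (A : set X)).

Lemma cl_fixset_infP (S : set cl_fixset) : infimums S (cl_fixset_inf S).
Proof.
split=> [A SA|B lbB]; rewrite cl_fixset_le; apply/asboolP.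
  by move=> x; apply.
by move=> x Bx A /lbB; rewrite cl_fixset_le => /asboolP; apply.
Qed.

Lemma cl_fixset_supP (S : set cl_fixset) : supremums S (cl_fixset_sup S).
Proof.
split=> [A SA|B ubB]; rewrite cl_fixset_le; apply/asboolP.
  by move=> x Ax; apply: cl_sub; exists A.
rewrite -(cl_fixsetE B); apply: clS => x [A /ubB].
by rewrite cl_fixset_le => /asboolP; apply.
Qed.

Lemma cl_setI (A B : cl_fixset) :
  cl ((A : set X) `&` (B : set X))%classic == ((A : set X) `&` (B : set X))%classic.
Proof.
apply/eqP/seteqP; split; last exact: cl_sub.
move=> x clx; split; rewrite -cl_fixsetE; apply: clS clx; first exact: subIsetl.
exact: subIsetr.
Qed.

Definition cl_fixset_meet (A B : cl_fixset) : cl_fixset := ClFixset (cl_setI A B).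

Definition cl_fixset_join (A B : cl_fixset) : cl_fixset :=
  cl_fix ((A : set X) `|` (B : set X))%classic.

Lemma cl_fixset_meetP (A B C : cl_fixset) :
  (A <= cl_fixset_meet B C) = (A <= B) && (A <= C).
Proof.
by rewrite !cl_fixset_le -asbool_and; congr asbool; rewrite propeqE subsetI.
Qed.

Lemma cl_fixset_joinP (A B C : cl_fixset) :
  (cl_fixset_join A B <= C) = (A <= C) && (B <= C).
Proof.
rewrite !cl_fixset_le -asbool_and; congr asbool; rewrite propeqE -subUset.
split=> [ABC|ABC]; first exact: subset_trans (@cl_sub _) ABC.
by rewrite -(cl_fixsetE C); exact: clS.
Qed.

HB.instance Definition _ := Order.POrder_MeetJoin_isLattice.Build
  (Order.Disp tt tt) cl_fixset cl_fixset_meetP cl_fixset_joinP.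

Lemma cl_fixset_bot (A : cl_fixset) : cl_fix set0 <= A.
Proof.
by rewrite cl_fixset_le; apply/asboolP; rewrite -(cl_fixsetE A); apply: clS.
Qed.

Lemma cl_fixset_top (A : cl_fixset) : A <= cl_fix setT.
Proof. by rewrite cl_fixset_le; apply/asboolP => x _; apply: cl_sub. Qed.

HB.instance Definition _ := Order.hasBottom.Build
  (Order.Disp tt tt) cl_fixset cl_fixset_bot.
HB.instance Definition _ := Order.hasTop.Build
  (Order.Disp tt tt) cl_fixset cl_fixset_top.

End Closure.
Arguments cl_fixset {X} r.

Section Lattices.
Context {d d' : Order.disp_t}.

Definition meet_dense (L : porderType d) (Lam : set L) :=
  forall x : L, exists2 S : set L, S `<=` Lam & infimums S x.

Definition antitone (L : porderType d) (neg : L -> L) :=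
  forall a b : L, a <= b -> neg b <= neg a.

Definition complete_lattice (L : porderType d) :=
  forall S : set L, infimums S !=set0 /\ supremums S !=set0.

Context {L : porderType d} {L' : porderType d'}.

Definition complete_embedding (neg : L -> L) (neg' : L' -> L') (f : L -> L') :=
  [/\ injective f,
      forall (S : set L) (m : L), infimums S m -> infimums (f @` S) (f m),
      forall (S : set L) (m : L), supremums S m -> supremums (f @` S) (f m)
    & {morph f : a / neg a >-> neg' a}].

Definition isomorphism (neg : L -> L) (neg' : L' -> L') (f : L -> L') :=
  [/\ bijective f, {mono f : a b / a <= b}
    & {morph f : a / neg a >-> neg' a}].

End Lattices.

Lemma cl_fixset_complete (X : Type) (r : X -> X -> Prop) :
  complete_lattice (cl_fixset r).
Proof.
move=> S; split; first by exists (cl_fixset_inf S); exact: cl_fixset_infP.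
by exists (cl_fixset_sup S); exact: cl_fixset_supP.
Qed.

Section Pairs.
Context {d : Order.disp_t} {L : tbLatticeType d}.
Variables (neg : L -> L) (Lam : set L).

Definition pairs : set (L * L) :=
  [set (a, neg a) | a in setT] `|` [set (\top, b) | b in Lam].

Definition pairs_rel (p q : pairs) : Prop := ~~ ((val q).1 <= (val p).2).

Lemma pairs_neg (a : L) : (a, neg a) \in pairs.
Proof. by apply/mem_set; left; exists a. Qed.

Definition neg_pair (a : L) : pairs := exist _ (a, neg a) (pairs_neg a).

(** The fixpoint [F] generated by the single pair [(neg \top, neg (neg \top))]. *)
Definition pairs_false : cl_fixset pairs_rel :=
  cl_fix pairs_rel [set neg_pair (neg \top)].

End Pairs.
Arguments pairs_rel {d L} neg Lam p q.

(* Main.v *)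
Require Import Defs.
From mathcomp Require Import all_boot all_order.
From mathcomp Require Import boolp classical_sets.

(** The closure of a set [A] of pairs consists of the pairs whose first
component lies below every second component bounding the first components of
[A].  As the second components include the meet-dense set [Lam], this makes
[a |-> {p in P | p.1 <= a}] a map into the closed sets; it reflects the order
because every [a] is a first component. *)

Set Implicit Arguments.
Unset Strict Implicit.
Unset Printing Implicit Defensive.

Import Order.TTheory.
Local Open Scope classical_set_scope.
Local Open Scope order_scope.

Section Embedding.
Context {d : Order.disp_t} {L : tbLatticeType d}.
Variables (Lam : set L) (neg : L -> L).

Local Notation P := (pairs neg Lam).
Local Notation rel := (pairs_rel neg Lam).

(** Contraposition of the definition of [cl], since [pairs_rel q p] denies that the first component
    of [p] lies below the second of [q]. *)
Lemma cl_pairsP (A : set P) (p : P) :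
  cl rel A p <->
  forall q : P, (forall s, A s -> (val s).1 <= (val q).2) ->
    (val p).1 <= (val q).2.
Proof.
split=> [clp q ubq|ubp q rqp].
  by apply: contrapT => /negP /clp[s /negP rqs /ubq].
apply: contrapT => nex; move/negP: rqp; apply; apply: ubp => s As.
by apply: contrapT => /negP rqs; apply: nex; exists s.
Qed.

Lemma pairs_top b : Lam b -> (\top, b) \in P.
Proof. by move=> Lb; apply/mem_set; right; exists b. Qed.

Hypothesis hLam : meet_dense Lam.

Lemma meet_dense_le (x a : L) :
  (forall b, Lam b -> a <= b -> x <= b) -> x <= a.
Proof.
move=> xb; have [S SLam [lbS glbS]] := hLam a.
by apply: glbS => b Sb; apply: xb; [exact: SLam|exact: lbS].
Qed.

(** The bound [a] need not be a second component, but it is a meet of elements [b] of [Lam], and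
    each such [b] is tested by the pair [(\top, b)]. *)
Lemma cl_pairs_below (a : L) (A : set P) :
  (forall s, A s -> (val s).1 <= a) -> forall p, cl rel A p -> (val p).1 <= a.
Proof.
move=> Aa p /cl_pairsP ubp; apply: meet_dense_le => b Lb ab.
apply: (ubp (exist _ (\top, b) (pairs_top Lb))) => s As /=.
exact: le_trans (Aa s As) ab.
Qed.

Lemma cl_down_pairs (a : L) :
  cl rel [set p | (val p).1 <= a] == [set p | (val p).1 <= a].
Proof.
apply/eqP/seteqP; split; last exact: cl_sub.
exact: cl_pairs_below.
Qed.

Definition down_pairs (a : L) : cl_fixset rel := ClFixset (cl_down_pairs a).

Lemma le_down_pairs : {mono down_pairs : a b / a <= b}.
Proof.
move=> a b; rewrite cl_fixset_le; apply/asboolP/idP => [ab|ab p /= pa].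
  exact: (ab (neg_pair neg Lam a) (lexx a)).
exact: le_trans pa ab.
Qed.

Lemma down_pairs_inj : injective down_pairs.
Proof. by move=> a b ab; apply/le_anti; rewrite -!le_down_pairs ab lexx. Qed.

Lemma down_pairs_infimums (S : set L) m :
  infimums S m -> infimums (down_pairs @` S) (down_pairs m).
Proof.
move=> [lbm glbm]; split=> [_ [a Sa <-]|B lbB].
  by rewrite le_down_pairs; exact: lbm.
rewrite cl_fixset_le; apply/asboolP => p Bp /=; apply: glbm => a Sa.
have := lbB _ (imageP _ Sa); rewrite cl_fixset_le => /asboolP; exact.
Qed.

Lemma down_pairs_supremums (S : set L) m :
  supremums S m -> supremums (down_pairs @` S) (down_pairs m).
Proof.
move=> [ubm lubm]; split=> [_ [a Sa <-]|B ubB].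
  by rewrite le_down_pairs; exact: ubm.
rewrite cl_fixset_le; apply/asboolP => p /= pm; rewrite -(cl_fixsetE B).
apply/cl_pairsP => q ubq; apply: le_trans pm _; apply: lubm => a Sa.
(* [B] contains [down_pairs a], hence the pair [(a, neg a)]. *)
apply: (ubq (neg_pair neg Lam a)).
have := ubB _ (imageP _ Sa); rewrite cl_fixset_le => /asboolP; apply.
exact: lexx.
Qed.

(** Writing the fixpoint as an image under [down_pairs] makes [neg_fix_downP] applicable to it. *)
Lemma pairs_falseE : pairs_false neg Lam = down_pairs (neg \top).
Proof.
apply/val_inj/seteqP; split=> [p|p /= pn].
  by apply: cl_pairs_below => s ->; exact: lexx.
apply/cl_pairsP => q ubq; apply: le_trans pn _.
exact: (ubq (neg_pair neg Lam (neg \top))).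
Qed.

(** Again contraposition: some [s] in [down_pairs c] satisfies [pairs_rel q s] exactly when
    [c <= (val q).2] fails, and then [(c, neg c)] is such an [s]. *)
Lemma neg_fix_downP (c : L) (A : cl_fixset rel) (p : P) :
  (neg_fix (down_pairs c) A : set P) p <->
  forall q : P, (A : set P) q -> c <= (val q).2 -> (val p).1 <= (val q).2.
Proof.
split=> [np q Aq cq|np q /negP rqp Aq].
  apply: contrapT => /negP rqp; have [s /negP rqs /= sc] := np q rqp Aq.
  by apply: rqs; exact: le_trans sc cq.
exists (neg_pair neg Lam c); last exact: lexx.
by apply/negP => /(np q Aq).
Qed.

Hypothesis hneg : antitone neg.

Lemma down_pairs_neg :
  {morph down_pairs : a / neg a >-> neg_fix (pairs_false neg Lam) a}.
Proof.
move=> a; rewrite pairs_falseE; apply/val_inj/seteqP;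
  split=> [p /= pna|p /neg_fix_downP np]; last first.
  (* The pair [(a, neg a)] is a legitimate test because antitonicity gives [neg \top <= neg a]. *)
  by apply: (np (neg_pair neg Lam a)); [exact: lexx|apply/hneg/lex1].
apply/(neg_fix_downP _ (down_pairs a)) => q /= qa nq; apply: le_trans pna _.
(* For [q = (c, neg c)], [c <= a] gives [neg a <= neg c]. For [q = (\top, b)], [\top <= a] forces
   [a = \top], and the goal becomes the assumption [neg \top <= b]. *)
case: q qa nq => _ /= /set_mem [[c _ <-]|[b _ <-]] /=; first by move/hneg.
by rewrite le1x => /eqP ->.
Qed.

(** The preimage of [A] is the supremum of its first components: a second component bounding all of
    these also bounds their supremum, so closedness of [A] applies. *)
Lemma down_pairs_surj : complete_lattice L ->
  forall A : cl_fixset rel, exists a, down_pairs a = A.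
Proof.
move=> cL A; have [_ [m [ubm lubm]]] := cL [set (val p).1 | p in (A : set P)].
exists m; apply/val_inj/seteqP; split=> [p /= pm|p Ap]; last first.
  by apply: ubm; exists p.
rewrite -(cl_fixsetE A); apply/cl_pairsP => q ubq; apply: le_trans pm _.
by apply: lubm => _ [s As <-]; exact: ubq.
Qed.

End Embedding.

Theorem theorem4p29 (d : Order.disp_t) (L : tbLatticeType d) (Lam : set L)
    (neg : L -> L) (hLam : meet_dense Lam) (hneg : antitone neg) :
  exists f : L -> cl_fixset (pairs_rel neg Lam),
    complete_embedding neg (neg_fix (pairs_false neg Lam)) f /\
    (complete_lattice L ->
       isomorphism neg (neg_fix (pairs_false neg Lam)) f).
Proof.
have f_inj := @down_pairs_inj _ _ _ neg hLam.
have f_neg := down_pairs_neg hLam hneg.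
exists (down_pairs neg hLam); split=> [|cL].
  split=> //; first exact: down_pairs_infimums.
  exact: down_pairs_supremums.
split=> //; last exact: le_down_pairs.
have [g fgK] := choice (down_pairs_surj (neg := neg) hLam cL).
by exists g => // a; apply: f_inj; rewrite fgK.
Qed.
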